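(* Let $\|\cdot\|$ be a norm on $\mathbb{R}^2$, $\aleph_0=\{\mathbf{v}\in\mathbb{R}_+^2:\|\mathbf{v}\|=1\}$, $\alpha_1,\alpha_2>0$, and $$\mathcal{E}_0:=\{(x,y)\in\mathbb{R}_+^2:(x^{\alpha_1},y^{\alpha_2})\in\aleph_0\}.$$ Let $h\in RV_\rho$ with $\rho<0$, and let $u:\mathbb{Z}_+^2\to\mathbb{R}_+$. Suppose there exists a limit function $\lambda_0>0$ defined on $\mathcal{E}_0$ such that $$\lim_{t\to\infty}\frac{u([t^{1/\alpha_1}x],[t^{1/\alpha_2}y])}{h(t)}=\lambda_0(x,y)\qquad\text{for all }(x,y)\in\mathcal{E}_0,\qquad( * )$$ where $t$ runs through the positive reals. Then: 1. The doubly indexed function $u(i,j)$ is regularly varying: for all $x,y>0$, with $\mathbf{w}=\mathbf{w}(x,y):=(x^{\alpha_1},y^{\alpha_2})$, $$\lim_{n\to\infty}\frac{u([n^{1/\alpha_1}x],[n^{1/\alpha_2}y])}{h(n)}=\lambda(x,y):=\lambda_0\left(\frac{x}{\|\mathbf{w}\|^{1/\alpha_1}},\frac{y}{\|\mathbf{w}\|^{1/\alpha_2}}\right)\|\mathbf{w}\|^{\rho}>0 .$$ 2. $u(i,j)$ is embeddable in a non-standard regularly varying function $f:\mathbb{R}_+^2\to\mathbb{R}$ with limit function $\lambda(\cdot)$ (and scaling functions $b_i(t)=t^{1/\alpha_i}$, $i=1,2$) such that $f(x,y)=u([x],[y])$. 3. If the convergence in $( * )$ is uniform on $\mathcal{E}_0$,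 then also $$\lim_{t\to\infty}\ \sup_{(x,y)\in\mathcal{E}_0}\left|\frac{f(t^{1/\alpha_1}x,t^{1/\alpha_2}y)}{h(t)}-\lambda_0(x,y)\right|=0 .$$
   Context: $\mathbb{Z}_+=\{0,1,2,\dots\}$, $\mathbb{R}_+=[0,\infty)$, and $[x]$ is the largest integer $\le x$. For $\rho\in\mathbb{R}$, $h\in RV_\rho$ means that $h:(0,\infty)\to(0,\infty)$ is measurable and $\lim_{t\to\infty}h(tx)/h(t)=x^\rho$ for all $x>0$. A measurable function $f$ on $\mathbb{R}_+^2$ is (non-standard) regularly varying with scaling functions $b_1,b_2$ and limit function $\lambda$ if there is $h\in RV_\alpha$ for some $\alpha\in\mathbb{R}$ such that $\lim_{t\to\infty}f(b_1(t)x,b_2(t)y)/h(t)=\lambda(x,y)>0$ for all $x,y>0$ ($t$ real). $u$ is embeddable if $f(x,y):=u([x],[y])$ is regularly varying in this sense. *)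

(* Defs.v *)
From HB Require Import structures.
From mathcomp Require Import all_boot all_order all_algebra.
From mathcomp Require Import all_classical all_reals all_analysis.
Set Implicit Arguments.
Unset Strict Implicit.
Unset Printing Implicit Defensive.
Import Order.TTheory GRing.Theory Num.Theory.
Import numFieldTopology.Exports numFieldNormedType.Exports.
Local Open Scope classical_set_scope.
Local Open Scope ring_scope.

(* The norm is an arbitrary parameter, so the canonical (sup) norm of the
   library on R * R is not used. *)
Definition is_norm2 (R : realType) (N : R * R -> R) : Prop :=
  [/\ forall v, 0 <= N v,
      forall v, N v = 0 -> v = (0, 0),
      forall (a : R) v, N (a * v.1, a * v.2) = `|a| * N v
    & forall v w, N (v.1 + w.1, v.2 + w.2) <= N v + N w].

Definition quadrant (R : realType) : set (R * R) :=
  [set p | 0 <= p.1 /\ 0 <= p.2].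
Arguments quadrant : clear implicits.

Definition RV (R : realType) (rho : R) (h : R -> R) : Prop :=
  [/\ measurable_fun (`]0, +oo[ : set R) h,
      forall t : R, 0 < t -> 0 < h t
    & forall x : R, 0 < x -> h (t * x) / h t @[t --> +oo] --> x `^ rho].

(* Functions on (0, oo) or on the closed quadrant are total functions whose
   values elsewhere are irrelevant; positivity of b1 and b2 keeps the arguments
   of f inside the quadrant. *)
Definition regularly_varying2 (R : realType) (b1 b2 : R -> R)
    (lambda f : R * R -> R) : Prop :=
  [/\ measurable_fun (quadrant R) f,
      forall t : R, 0 < t -> 0 < b1 t /\ 0 < b2 t
    & exists (alpha : R) (h : R -> R), RV alpha h /\
        forall x y : R, 0 < x -> 0 < y ->
          f (b1 t * x, b2 t * y) / h t @[t --> +oo] --> lambda (x, y)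
          /\ 0 < lambda (x, y)].

(* Num.truncn is the integer part [x] as a nat when 0 <= x (and 0 when x < 0). *)
Definition step_ext (R : realType) (u : nat -> nat -> R) : R * R -> R :=
  fun p => u (Num.truncn p.1) (Num.truncn p.2).

Definition aleph0 (R : realType) (N : R * R -> R) : set (R * R) :=
  [set v | quadrant R v /\ N v = 1].

Definition E0 (R : realType) (N : R * R -> R) (alpha1 alpha2 : R) :
    set (R * R) :=
  [set p | quadrant R p /\ aleph0 N (p.1 `^ alpha1, p.2 `^ alpha2)].

Definition limit_fun (R : realType) (N : R * R -> R) (alpha1 alpha2 rho : R)
    (lambda0 : R * R -> R) : R * R -> R :=
  fun p =>
    let r := N (p.1 `^ alpha1, p.2 `^ alpha2) in
    lambda0 (p.1 / r `^ alpha1^-1, p.2 / r `^ alpha2^-1) * r `^ rho.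

(* Main.v *)
Require Import Defs.
From HB Require Import structures.
From mathcomp Require Import all_boot all_order all_algebra.
From mathcomp Require Import all_classical all_reals all_analysis.
Import Order.TTheory GRing.Theory Num.Theory.
Import numFieldTopology.Exports numFieldNormedType.Exports.
Local Open Scope classical_set_scope.
Local Open Scope ring_scope.

(* With r = ||(x^alpha1, y^alpha2)||, the point (x / r^(1/alpha1),
   y / r^(1/alpha2)) lies on E0 and t^(1/alpha) x = (t r)^(1/alpha)
   (x / r^(1/alpha)). Hence u(...) / h(t) is the quotient of the hypothesis,
   taken at time t r, multiplied by h(t r) / h(t), which tends to r^rho. *)

(** Every preimage under [F \o g] is a union of fibres of [g], and a countable one since [C] is
    countable. With [g] the coordinatewise integer part, this allows an arbitrary array in place of
    [F]. *)
Lemma measurable_comp_countable d d' (T : measurableType d)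
    (T' : measurableType d') (C : countType) (g : T -> C) (F : C -> T') :
  (forall c, measurable (g @^-1` [set c])) -> measurable_fun setT (F \o g).
Proof.
move=> mg _ Y _; rewrite setTI.
have -> : (F \o g) @^-1` Y = \bigcup_(c in F @^-1` Y) g @^-1` [set c].
  apply/seteqP; split => [x Yx|x [c Yc gxc]]; first by exists (g x).
  by rewrite /preimage/= gxc.
rewrite bigcup_mkcond; apply: countable_bigcupT_measurable => [|c].
  exact: countableP.
by case: ifP => //.
Qed.

Lemma measurable_truncn_preimage (R : realType) (i : nat) :
  measurable ((@Num.truncn R) @^-1` [set i]).
Proof.
have mle n : measurable [set x : R | (Num.truncn x <= n)%N].
  rewrite (_ : [set _ | _] = `]-oo, n.+1%:R[%classic) //.
  by apply/seteqP; split => x /=; rewrite in_itv/= truncn_le_nat.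
(* The fibre over 0 is a whole half-line, because [Num.truncn] is 0 on negative reals; every other
   fibre is the difference of two consecutive half-lines. *)
case: i => [|n].
  rewrite (_ : _ @^-1` _ = [set x : R | (Num.truncn x <= 0)%N]) //.
  by apply/seteqP; split => x /=; [move=> ->|rewrite leqn0 => /eqP].
rewrite (_ : _ @^-1` _ = [set x : R | (Num.truncn x <= n.+1)%N] `\`
                         [set x : R | (Num.truncn x <= n)%N]).
  exact: measurableD.
apply/seteqP; split => x /=; first by move=> ->; rewrite leqnn ltnn.
move=> [le_xn /negP]; rewrite -ltnNge => lt_nx.
by apply/eqP; rewrite eqn_leq le_xn.
Qed.

Lemma measurable_step_ext (R : realType) (u : nat -> nat -> R) :
  measurable_fun setT (step_ext u).
Proof.
pose g (p : R * R) := (Num.truncn p.1, Num.truncn p.2).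
apply: (@measurable_comp_countable _ _ _ _ _ g (fun c => u c.1 c.2)) => -[i j].
rewrite (_ : g @^-1` _ = fst @^-1` ((@Num.truncn R) @^-1` [set i]) `&`
                         snd @^-1` ((@Num.truncn R) @^-1` [set j])).
  apply: measurableI; rewrite -[X in measurable X]setTI.
    by apply: measurable_fst => //; exact: measurable_truncn_preimage.
  by apply: measurable_snd => //; exact: measurable_truncn_preimage.
by apply/seteqP; split => p /=; [case=> -> ->|rewrite /g => -[-> ->]].
Qed.

Lemma is_norm2_gt0 (R : realType) (N : R * R -> R) (v : R * R) :
  is_norm2 N -> v.1 != 0 -> 0 < N v.
Proof.
move=> [N_ge0 N_eq0 _ _] v1; rewrite lt_neqAle N_ge0 andbT eq_sym.
by apply: contra v1 => /eqP/N_eq0 ->.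
Qed.

Section Scaling.
Context {R : realType}.
Variables (N : R * R -> R) (alpha1 alpha2 : R).
Hypotheses (N_norm : is_norm2 N) (alpha1_gt0 : 0 < alpha1)
  (alpha2_gt0 : 0 < alpha2).

Let powRVK (alpha r : R) : 0 < alpha -> 0 <= r -> (r `^ alpha^-1) `^ alpha = r.
Proof. by move=> a0 r0; rewrite -powRrM mulVf ?gt_eqF// powRr1. Qed.

(** Taking the powers [alpha1] and [alpha2] of the scaled coordinates multiplies the vector of norm
    [r] by [r^-1], so homogeneity gives norm 1. *)
Lemma E0_scaled (x y : R) (r := N (x `^ alpha1, y `^ alpha2)) :
  0 < x -> 0 < y -> E0 N alpha1 alpha2 (x / r `^ alpha1^-1, y / r `^ alpha2^-1).
Proof.
move=> x0 y0.
have r0 : 0 < r by apply: is_norm2_gt0 => //=; rewrite gt_eqF ?powR_gt0.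
have q a z : 0 < z -> 0 <= z / r `^ a by move=> z0; rewrite divr_ge0 ?powR_ge0 ?ltW.
have scaled a z : 0 < a -> 0 < z -> (z / r `^ a^-1) `^ a = r^-1 * z `^ a.
  move=> a0 z0; rewrite powRM ?invr_ge0 ?powR_ge0 ?ltW//.
  rewrite -[(r `^ _)^-1]powR_inv1 ?powR_ge0// -powRrM mulrC mulN1r powRN.
  by rewrite powRVK// ltW.
split; first by split; exact: q.
split; first by split; exact: powR_ge0.
case: N_norm => _ _ N_hom _.
rewrite /= !scaled// (N_hom r^-1 (_, _)) ger0_norm ?invr_ge0 ?(ltW r0)//.
by rewrite mulVf// gt_eqF.
Qed.

Lemma limit_fun_cvg (rho : R) (h : R -> R) (u : nat -> nat -> R)
    (lambda0 : R * R -> R) (h_RV : RV rho h)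
    (u_cvg : forall x y, E0 N alpha1 alpha2 (x, y) ->
       u (Num.truncn (t `^ alpha1^-1 * x)) (Num.truncn (t `^ alpha2^-1 * y))
         / h t @[t --> +oo] --> lambda0 (x, y)) (x y : R) :
  0 < x -> 0 < y ->
  u (Num.truncn (t `^ alpha1^-1 * x)) (Num.truncn (t `^ alpha2^-1 * y))
    / h t @[t --> +oo] --> limit_fun N alpha1 alpha2 rho lambda0 (x, y).
Proof.
case: h_RV => _ h_gt0 h_cvg x0 y0.
have := E0_scaled x y x0 y0; rewrite /limit_fun /=.
set r := N _ => xyE.
have r0 : 0 < r by apply: is_norm2_gt0 => //=; rewrite gt_eqF ?powR_gt0.
have ry : t * r @[t --> +oo] --> +oo by apply: gt0_cvgMly => //; exact: cvg_id.
apply: cvg_trans (cvgM (cvg_comp _ _ ry (u_cvg _ _ xyE)) (h_cvg _ r0)).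
(* The product of the two quotients equals the target only for [t > 0], where powers of [t * r]
   split and the nonzero factor [h (t * r)] cancels. *)
apply: near_eq_cvg; near=> t.
have t0 : 0 < t by near: t; exact: nbhs_pinfty_gt.
have rescale a z : (t * r) `^ a * (z / r `^ a) = t `^ a * z.
  by rewrite powRM ?ltW// mulrACA divff ?gt_eqF ?powR_gt0// mulr1.
by rewrite /= !rescale mulrA divfK// gt_eqF// h_gt0// mulr_gt0.
Unshelve. all: by end_near. Qed.

Lemma limit_fun_gt0 (rho : R) (lambda0 : R * R -> R) (x y : R) :
  (forall p, E0 N alpha1 alpha2 p -> 0 < lambda0 p) -> 0 < x -> 0 < y ->
  0 < limit_fun N alpha1 alpha2 rho lambda0 (x, y).
Proof.
move=> lambda0_gt0 x0 y0; rewrite mulr_gt0//.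
  by apply: lambda0_gt0; exact: E0_scaled.
by rewrite powR_gt0// is_norm2_gt0//= gt_eqF ?powR_gt0.
Qed.

End Scaling.

(** A uniform bound [e] on the deviations over [A] bounds their supremum by [e]. The supremum is
    taken in [\bar R], so that an unbounded family gets the value [+oo] and not a default real. *)
Lemma uniform_cvg_ereal_sup (R : realType) (T : choiceType) (I : Type)
    (G : set_system I) {FG : ProperFilter G} (A : set T)
    (F : I -> T -> R) (l : T -> R) :
  A !=set0 -> {uniform A, F t @[t --> G] --> l} ->
  ereal_sup [set `|F t p - l p|%:E | p in A] @[t --> G] --> (0%E : \bar R).
Proof.
move=> [p0 Ap0] Fl.
(* A point of [A] is essential here: the supremum of the empty set is [-oo]. *)
have sup_ge0 t : (0%E <= ereal_sup [set `|F t p - l p|%:E | p in A])%E.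
  apply: (@le_trans _ _ (`|F t p0 - l p0|%:E)); first by rewrite lee_fin.
  by apply: ereal_sup_ubound; exists p0.
have sup_le e : 0 < e -> \forall t \near G,
    (ereal_sup [set `|F t p - l p|%:E | p in A] <= e%:E)%E.
  move=> e0.
  have : \forall t \near G, forall p, A p -> ball (l p) e (F t p).
    (* The functions within [e] of [l] on [A] form a uniform neighbourhood of [l], given by the
       entourage of pairs at distance less than [e]. *)
    apply: (Fl [set f : T -> R | forall p, A p -> ball (l p) e (f p)]).
    apply/uniform_nbhs.
    exists [set xy : R * R | ball xy.1 e xy.2]; split => //.
    exact: entourage_ball (PosNum e0).
  apply: filterS => t Ft; apply: ge_ereal_sup => _ [p Ap <-].
  by rewrite lee_fin distrC ltW//; exact: Ft.
(* Convergence to a finite limit in [\bar R] means eventual finiteness, for which the bound 1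
   suffices, together with convergence of the real parts. *)
apply/fine_cvgP; split.
  have := sup_le 1 ltr01; apply: filterS => t le1.
  by rewrite ge0_fin_numE// (le_lt_trans le1)// ltry.
apply/cvgrPdist_le => e e0; have := sup_le e e0; apply: filterS => t lee /=.
have fin : ereal_sup [set `|F t p - l p|%:E | p in A] \is a fin_num.
  by rewrite ge0_fin_numE// (le_lt_trans lee)// ltry.
by rewrite sub0r normrN ger0_norm ?fine_ge0// -lee_fin fineK.
Qed.

Theorem corollary4p1 (R : realType) (N : R * R -> R) (alpha1 alpha2 rho : R)
    (h : R -> R) (u : nat -> nat -> R) (lambda0 : R * R -> R)
    (N_norm : is_norm2 N) (alpha1_gt0 : 0 < alpha1) (alpha2_gt0 : 0 < alpha2)
    (rho_lt0 : rho < 0) (h_RV : RV rho h) (u_ge0 : forall i j, 0 <= u i j)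
    (lambda0_gt0 : forall p, E0 N alpha1 alpha2 p -> 0 < lambda0 p)
    (u_cvg : forall x y, E0 N alpha1 alpha2 (x, y) ->
       u (Num.truncn (t `^ alpha1^-1 * x)) (Num.truncn (t `^ alpha2^-1 * y))
         / h t @[t --> +oo] --> lambda0 (x, y)) :
  let lambda := limit_fun N alpha1 alpha2 rho lambda0 in
  let f := step_ext u in
  [/\ forall x y : R, 0 < x -> 0 < y ->
        u (Num.truncn (n%:R `^ alpha1^-1 * x))
          (Num.truncn (n%:R `^ alpha2^-1 * y)) / h n%:R @[n --> \oo]
          --> lambda (x, y)
        /\ 0 < lambda (x, y),
      regularly_varying2 (fun t => t `^ alpha1^-1) (fun t => t `^ alpha2^-1)
        lambda f
    & {uniform E0 N alpha1 alpha2,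
         (fun p : R * R => u (Num.truncn (t `^ alpha1^-1 * p.1))
                             (Num.truncn (t `^ alpha2^-1 * p.2)) / h t)
         @[t --> +oo] --> lambda0} ->
      ereal_sup [set `|f (t `^ alpha1^-1 * p.1, t `^ alpha2^-1 * p.2) / h t
                       - lambda0 p|%:E | p in E0 N alpha1 alpha2]
        @[t --> +oo] --> (0%E : \bar R)].
Proof.
move=> lambda f.
have cvg_u := @limit_fun_cvg R N alpha1 alpha2 N_norm alpha1_gt0 alpha2_gt0
  rho h u lambda0 h_RV u_cvg.
have lambda_gt0 x y : 0 < x -> 0 < y -> 0 < lambda (x, y).
  by move=> x0 y0; exact: limit_fun_gt0.
split.
- move=> x y x0 y0; split; last exact: lambda_gt0.
  exact: cvg_comp cvgr_idn (cvg_u x y x0 y0).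
- split.
  + apply: measurable_funS (@measurableT _ (R * R)%type) (@subsetT _ _) _.
    exact: measurable_step_ext.
  + by move=> t t0; split; exact: powR_gt0.
  (* The normalising function is [h] itself, with index [rho]. *)
  + exists rho, h; split => // x y x0 y0; split; last exact: lambda_gt0.
    exact: cvg_u.
- move=> u_unif; apply: uniform_cvg_ereal_sup _ u_unif.
  (* [E0] is nonempty: it contains the rescaled point [(1, 1)]. *)
  by eexists; exact: (E0_scaled _ _ _ N_norm alpha1_gt0 alpha2_gt0 1 1).
Qed.
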